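(* For each positive integer $n$, let $C_{n}(x)=\sum_{i=1}^n C_{n,i}x^i$, where $C_{n,i}$ is the number of elements of $Q_n$ with exactly $i$ descents. Then for all positive integers $n$, the roots of the polynomial $C_{n}(x)$ are all real, distinct, and non-positive.
   Context: For a positive integer $n$, $Q_n$ denotes the set of Stirling permutations: all permutations $q=a_1a_2\cdots a_{2n}$ of the multiset $\{1,1,2,2,\ldots,n,n\}$ such that for every $i\in\{1,\dots,n\}$, all entries located between the two occurrences of $i$ are larger than $i$. An index $i$ with $1\le i\le 2n$ is a descent of $q$ if $i=2n$ or $a_i>a_{i+1}$; thus $i=2n$ always counts as a descent. *)

(* Defs.v *)
From mathcomp Require Import all_boot all_order all_algebra.
From mathcomp.real_closed Require Import complex.

Set Implicit Arguments.
Unset Strict Implicit.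
Unset Printing Implicit Defensive.

Import GRing.Theory Num.Theory.
Local Open Scope ring_scope.

Definition double_word (n : nat) : seq nat :=
  flatten [seq [:: i; i] | i <- iota 1 n].

(* In a rearrangement of [double_word n] every value occurs exactly twice, so
   positions j < l with equal entries are the two occurrences of that value. *)
Definition is_stirling (q : seq nat) : bool :=
  [forall j : 'I_(size q), forall k : 'I_(size q), forall l : 'I_(size q),
     [&& (j < k)%N, (k < l)%N & nth 0%N q j == nth 0%N q l] ==>
       (nth 0%N q j < nth 0%N q k)%N].

(* [permutations] is duplicate-free also when its argument has repetitions, so
   this list enumerates the set of Stirling permutations without repetition. *)
Definition stirling_perms (n : nat) : seq (seq nat) :=
  [seq q <- permutations (double_word n) | is_stirling q].

(* Descents are 1-based: the entry a_i is [nth 0 q i.-1]. *)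
Definition is_descent (q : seq nat) (i : nat) : bool :=
  (i == size q) || (nth 0%N q i.-1 > nth 0%N q i)%N.

Definition descents (q : seq nat) : nat :=
  count (is_descent q) (iota 1 (size q)).

Definition stirling_count (n i : nat) : nat :=
  count (fun q => descents q == i) (stirling_perms n).

Definition stirling_poly (A : nzRingType) (n : nat) : {poly A} :=
  \sum_(1 <= i < n.+1) (stirling_count n i)%:R *: 'X^i.

(* Main.v *)
Require Import Defs.
From mathcomp Require Import all_boot all_order all_algebra.
From mathcomp.real_closed Require Import complex polyrcf.
From mathcomp Require Import ring.

Set Implicit Arguments.
Unset Strict Implicit.
Unset Printing Implicit Defensive.

(* Every Stirling permutation of order n + 1 arises uniquely from one of order
   n by inserting the adjacent pair (n+1)(n+1) into one of its 2n + 1 gaps; the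
   number of descents grows by one unless the gap is itself a descent.  Hence
     C_(n+1) = x D,   D = (1 - x) C_n' + (2n+1) C_n.
   If C_n has n distinct roots s_0 < ... < s_(n-1) <= 0 and positive leading
   coefficient, then D(s_i) has the sign of C_n'(s_i), which alternates, while
   D has degree n, positive leading coefficient and hence the opposite sign to
   D(s_0) near -oo.  So D has a root in each of ]-oo, s_0[, ]s_0, s_1[, ...,
   and together with 0 these are n + 1 distinct nonpositive roots of C_(n+1). *)

Import GRing.Theory Num.Theory.

(** * The Stirling condition in terms of subsequences a b a *)

Lemma is_stirlingP (q : seq nat) :
  reflect (forall a b, subseq [:: a; b; a] q -> a < b) (is_stirling q).
Proof.
apply: (iffP idP) => [Hq a b Hs | Hq].
  have : exists j k l, [/\ j < k < l, l < size q,
     nth 0 q j = a, nth 0 q k = b & nth 0 q l = a].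
    elim: q {Hq} Hs => [|x q IH] //=.
    case: eqP => [-> | _] Hs; last first.
      have [j [k [l [jkl lq ja kb la]]]] := IH Hs.
      by exists j.+1, k.+1, l.+1.
    suff [k [l [kl lq kb la]]] : exists k l,
        [/\ k < l, l < size q, nth 0 q k = b & nth 0 q l = x].
      by exists 0, k.+1, l.+1.
    elim: q {IH} Hs => [|y q IH] //=.
    case: eqP => [-> | _] Hs; last first.
      have [k [l [kl lq kb la]]] := IH Hs.
      by exists k.+1, l.+1.
    exists 0, (index x q).+1; rewrite sub1seq in Hs.
    by rewrite /= !ltnS index_mem nth_index.
  case=> j [k [l [/andP[jk kl] lq ja kb la]]].
  have kq := ltn_trans kl lq; have jq := ltn_trans jk kq.
  move/forallP: Hq => /(_ (Ordinal jq))/forallP/(_ (Ordinal kq)).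
  move=> /forallP/(_ (Ordinal lq))/implyP /=.
  by rewrite ja kb la; apply; rewrite jk kl eqxx.
apply/forallP=> j; apply/forallP=> k; apply/forallP=> l.
apply/implyP=> /and3P[jk kl /eqP jl]; apply: Hq.
rewrite {2}jl.
pose jkl : seq nat := [:: nat_of_ord j; nat_of_ord k; nat_of_ord l].
rewrite -[X in subseq X _]/(map (nth 0 q) jkl).
rewrite -[X in subseq _ X](mkseq_nth 0 q) /mkseq; apply: map_subseq.
(* A strictly increasing list of positions is a filter of [iota 0 (size q)], hence a subsequence of
   it. *)
have -> : jkl = [seq i <- iota 0 (size q) | i \in jkl].
  apply: (irr_sorted_eq ltn_trans ltnn) => /=.
  - by rewrite jk kl.
  - by apply: sorted_filter; [apply: ltn_trans | apply: iota_ltn_sorted].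
  - move=> i; rewrite mem_filter mem_iota /= add0n.
    by case: (boolP (i \in _)) => //; rewrite !inE => /or3P[] /eqP ->; rewrite ltn_ord.
exact: filter_subseq.
Qed.

(** * Insertion of an adjacent pair and its effect on descents *)

Definition insert_pair (m k : nat) (q : seq nat) := take k q ++ [:: m, m & drop k q].

Lemma descents_cons x s :
  descents (x :: s) = ((s == [::]) || (head 0 s < x)) + descents s.
Proof.
rewrite /descents /=.
have -> : iota 2 (size s) = [seq 1 + i | i <- iota 1 (size s)] by rewrite -iotaDl.
rewrite count_map; congr (_ + _).
  by rewrite {1}/is_descent /= nth0 eqSS eq_sym size_eq0.
by apply: eq_in_count => -[|i]; rewrite mem_iota.
Qed.

(** The second copy of [m] is always a descent, the first never is, and the entry before the gap, if
    any, stops being one. The guard [0 < k] matters for the empty word, where [is_descent] holds at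
    index 0. *)
Lemma descents_insert_pair m k q : all (ltn^~ m) q -> k <= size q ->
  descents (insert_pair m k q) = descents q + ~~ ((0 < k) && is_descent q k).
Proof.
elim: q k => [|x s IH] [|k] //=; rewrite /insert_pair //=.
- by rewrite !descents_cons /= ltnn.
- move=> /andP[xm _] _; rewrite !descents_cons /= ltnn xm /=.
  by rewrite add0n addnC.
move=> /andP[xm sm]; rewrite ltnS => ks.
have := IH _ sm ks.
rewrite descents_cons [descents (x :: s)]descents_cons /insert_pair => ->.
case: k ks => [|k] ks /=.
  rewrite take0 /= ltnNge (ltnW xm) /= /is_descent /= nth0 eqSS [0 == _]eq_sym size_eq0.
  by rewrite add0n; case: (_ || _); rewrite ?addn0 ?addn1 // add1n.
case: s ks {IH sm} => [|y s] //= ks.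
by rewrite addnA.
Qed.

(** * The insertion bijection from order n to order n + 1 *)

Lemma mem_stirling_perms n q :
  (q \in stirling_perms n) = is_stirling q && perm_eq q (double_word n).
Proof. by rewrite mem_filter mem_permutations. Qed.

Lemma double_wordS n : perm_eq (double_word n.+1) [:: n.+1, n.+1 & double_word n].
Proof.
rewrite /double_word -[X in iota 1 X]addn1 iotaD map_cat flatten_cat /= add1n.
by rewrite perm_catC.
Qed.

Lemma mem_double_word n i : (i \in double_word n) = (0 < i <= n).
Proof.
elim: n => [|n IH]; first by case: i.
rewrite (perm_mem (double_wordS n)) !inE IH orbA orbb.
by rewrite [i <= n.+1]leq_eqVlt ltnS; case: eqP => [->|].

Qed.

Lemma size_double_word n : size (double_word n) = n.*2.
Proof. by elim: n => // n IH; rewrite (perm_size (double_wordS n)) /= IH doubleS. Qed.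

Lemma stirling_perms_lt n q : q \in stirling_perms n -> all (ltn^~ n.+1) q.
Proof.
rewrite mem_stirling_perms => /andP[_ qn]; apply/allP=> i.
by rewrite (perm_mem qn) mem_double_word => /andP[].
Qed.

Lemma size_stirling_perms n q : q \in stirling_perms n -> size q = n.*2.
Proof.
by rewrite mem_stirling_perms => /andP[_ /perm_size->]; apply: size_double_word.
Qed.

Lemma subseq_skip (T : eqType) (x : T) s r t :
  x \notin r -> subseq (x :: s) (r ++ t) = subseq (x :: s) t.
Proof.
by elim: r => //= y r IH; rewrite inE negb_or => /andP[/negPf-> /IH].
Qed.

(** With [index_insert_pair], this recovers both the word and the gap, so insertion is injective. *)
Lemma filter_insert_pair m k q : m \notin q ->
  filter (predC1 m) (insert_pair m k q) = q.
Proof.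
move=> mq; rewrite /insert_pair filter_cat /= eqxx /= -filter_cat cat_take_drop.
by apply/all_filterP/allP=> x xq /=; apply: contraNneq mq => <-.
Qed.

Lemma index_insert_pair m k q : m \notin q -> k <= size q ->
  index m (insert_pair m k q) = k.
Proof.
move=> mq kq; rewrite /insert_pair index_cat.
have /negPf-> : m \notin take k q by apply: contra mq; apply: mem_take.
by rewrite /= eqxx addn0 size_take_min; apply/minn_idPl.
Qed.

Lemma perm_insert_pair m k q : perm_eq (insert_pair m k q) [:: m, m & q].
Proof.
rewrite /insert_pair perm_catC /= !perm_cons perm_catC.
by rewrite cat_take_drop.
Qed.

(** In a pattern a b a, the value n + 1 cannot be a, its two copies being adjacent, and is harmless
    as b, being the maximum. Any other pattern survives deletion of the pair and so occurs in
    [q]. *)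
Lemma insert_pair_stirling n k q : q \in stirling_perms n ->
  insert_pair n.+1 k q \in stirling_perms n.+1.
Proof.
move=> Hq; have qlt := stirling_perms_lt Hq.
have nq : n.+1 \notin q by apply/negP => /(allP qlt) /=; rewrite ltnn.
move: Hq; rewrite !mem_stirling_perms => /andP[/is_stirlingP Hq qn].
have pE := perm_insert_pair n.+1 k q.
have -> /= : perm_eq (insert_pair n.+1 k q) (double_word n.+1).
  rewrite (perm_trans pE) // perm_sym (perm_trans (double_wordS n)) //.
  by rewrite !perm_cons perm_sym.
rewrite andbT; apply/is_stirlingP => a b Hab.
have le : a <= n.+1.
  have : a \in insert_pair n.+1 k q by apply: (mem_subseq Hab); rewrite mem_head.
  by rewrite (perm_mem pE) !inE orbA orbb => /orP[/eqP->|/(allP qlt)/ltnW].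
have [aE|an] := eqVneq a n.+1.
  move: Hab; rewrite aE /insert_pair.
  rewrite subseq_skip; last by apply: contra nq; apply: mem_take.
  rewrite /= eqxx; case: eqP => [_|_ /mem_subseq/(_ n.+1)].
    by rewrite sub1seq => /mem_drop; rewrite (negPf nq).
  by rewrite !inE eqxx orbT => /(_ isT)/mem_drop; rewrite (negPf nq).
have [->|bn] := eqVneq b n.+1; first by rewrite ltn_neqAle an.
apply: Hq; rewrite -(filter_insert_pair k nq) subseq_filter /= an bn.
exact: Hab.
Qed.

(** An entry between the two copies of the maximum would have to exceed it, so the copies are
    adjacent and can be removed. *)
Lemma stirling_permsS_insert_pair n q : q \in stirling_perms n.+1 ->
  exists q' k,
    [/\ q' \in stirling_perms n, k <= size q' & q = insert_pair n.+1 k q'].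
Proof.
set m := n.+1; rewrite mem_stirling_perms => /andP[/is_stirlingP Hq qn].
have mq : m \in q by rewrite (perm_mem qn) mem_double_word leqnn.
have qle i : i \in q -> i <= m by rewrite (perm_mem qn) mem_double_word => /andP[].
have {qn} qn := perm_trans qn (double_wordS n).
set k := index m q; set r := drop k.+1 q.
have kq : k < size q by rewrite index_mem.
have qE : q = take k q ++ m :: r.
  by rewrite -[m in RHS](nth_index 0 mq) -drop_nth // cat_take_drop.
have rn : perm_eq (take k q ++ r) (m :: double_word n).
  rewrite -(perm_cons m) -(permPr qn) [X in perm_eq _ X]qE.
  by rewrite -[m :: r]cat1s perm_sym perm_catCA.
have mk : m \notin take k q by rewrite in_take // ltnn.
have : m \in r by move: (perm_mem rn m); rewrite mem_cat (negPf mk) mem_head.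
case: r => [//|x r] in qE rn *; rewrite inE => /predU1P[xm | mr]; last first.
  suff /Hq : subseq [:: m; x; m] q.
    by rewrite ltnNge qle // qE mem_cat !inE eqxx !orbT.
  rewrite qE; apply: (subseq_trans _ (suffix_subseq _ _)).
  by rewrite /= !eqxx sub1seq.
subst x; have sk : size (take k q) = k by rewrite size_takel // ltnW.
have qE' : q = insert_pair m k (take k q ++ r).
  by rewrite /insert_pair take_size_cat // drop_size_cat.
exists (take k q ++ r), k; split=> //; last by rewrite size_cat sk leq_addr.
rewrite mem_stirling_perms; apply/andP; split.
  apply/is_stirlingP => a b sab; apply: Hq; apply: subseq_trans sab _.
  rewrite [X in subseq _ X]qE; apply: cat_subseq => //.
  exact: (suffix_subseq [:: m; m]).
by rewrite -(perm_cons m) -(permPr rn) perm_sym -[m :: r]cat1s perm_catCA.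
Qed.

Lemma perm_stirling_permsS n :
  perm_eq (stirling_perms n.+1)
    [seq insert_pair n.+1 k q | q <- stirling_perms n, k <- iota 0 (size q).+1].
Proof.
have notin q : q \in stirling_perms n -> n.+1 \notin q.
  by move=> /stirling_perms_lt/allP qlt; apply/negP => /qlt /=; rewrite ltnn.
apply: uniq_perm.
- exact/filter_uniq/permutations_uniq.
- apply: allpairs_uniq_dep; first exact/filter_uniq/permutations_uniq.
    by move=> q _; apply: iota_uniq.
  move=> _ _ /allpairsPdep[q [k [Hq Hk ->]]] /allpairsPdep[q' [k' [Hq' Hk' ->]]] /= E.
  have qE : q = q'.
    by rewrite -(filter_insert_pair k (notin _ Hq)) E filter_insert_pair ?notin.
  subst q'; congr existT.
  move: Hk Hk'; rewrite !mem_iota /= !add0n !ltnS => kq kq'.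
  by rewrite -(index_insert_pair (notin _ Hq) kq) E index_insert_pair ?notin.
move=> q; apply/idP/allpairsPdep => [/stirling_permsS_insert_pair|].
  case=> q' [k [Hq' kq ->]]; exists q', k.
  by rewrite mem_iota ltnS.
by case=> q' [k [Hq' _ ->]]; apply: insert_pair_stirling.
Qed.

(** * The descent generating function and its recurrence *)

Local Open Scope ring_scope.

(** Summing over words lets the insertion bijection act termwise, and the value 1 at n = 0 starts
    the induction, whereas [stirling_poly] is 0 there. *)
Definition descent_gf (A : nzRingType) (n : nat) : {poly A} :=
  \sum_(q <- stirling_perms n) 'X^(descents q).

Lemma descent_gf0 (A : nzRingType) : descent_gf A 0%N = 1.
Proof.
rewrite /descent_gf; suff -> : stirling_perms 0%N = [:: [::]] by rewrite big_seq1.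
apply: perm_small_eq => //; apply: uniq_perm => //.
  exact/filter_uniq/permutations_uniq.
move=> q; rewrite mem_stirling_perms inE; case: q => [|x q] /=.
  by rewrite perm_refl andbT; apply/is_stirlingP.
by apply/negbTE; rewrite negb_and; apply/orP; right; apply/negP => /perm_size.
Qed.

(** A word with d descents has d gaps contributing x^d and 2n + 1 - d gaps contributing x^(d+1);
    their sum is x ((1 - x) d x^(d-1) + (2n + 1) x^d). *)
Lemma descent_gfS (A : comNzRingType) n :
  descent_gf A n.+1 =
  'X * ((1 - 'X) * (descent_gf A n)^`() + n.*2.+1%:R * descent_gf A n).
Proof.
rewrite /descent_gf (perm_big _ (perm_stirling_permsS n)).
rewrite big_allpairs_dep /= raddf_sum /= !mulr_sumr -big_split mulr_sumr /=.
apply: eq_big_seq => q Hq.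
pose b k := (0 < k)%N && is_descent q k.
rewrite (eq_big_seq (fun k => 'X^(descents q) * 'X^(~~ b k))); last first.
  move=> k; rewrite -[_ :: _]/(iota 0 (size q).+1) mem_iota ltnS => kq.
  by rewrite descents_insert_pair ?exprD //; apply: stirling_perms_lt.
rewrite -mulr_sumr (bigID b) /=.
rewrite (eq_bigr (fun=> 1)) => [|k ->//]; rewrite addrC.
rewrite (eq_bigr (fun=> 'X)) => [|k /negPf->//].
have cb : count b (iota 0 (size q).+1) = descents q.
  rewrite /= add0n; apply: eq_in_count => i.
  by rewrite mem_iota /b => /andP[-> _].
have cb' : (count (predC b) (iota 0 (size q).+1) + descents q = n.*2.+1)%N.
  by rewrite addnC -cb count_predC size_iota (size_stirling_perms Hq).
rewrite !big_const_seq !iter_addr_0 cb.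
set c := count _ _.
have -> : n.*2.+1%:R = c%:R + (descents q)%:R :> {poly A}.
  by rewrite -natrD cb'.
rewrite derivXn -['X *+ c]mulr_natr -[X in (1 - 'X) * X]mulr_natr.
(* The derivative has the truncated exponent [_.-1], so 0 is treated apart. *)
case: (descents q) {cb cb'} => [|d].
  by move: c%:R => c'; rewrite expr0; ring.
by rewrite exprS /=; move: c%:R d.+1%:R ('X^d) => c' d' y; ring.
Qed.

(** [stirling_poly] keeps only the indices 1 to n. The others carry no coefficient: the factor x of
    the recurrence kills index 0, and the size hypothesis, later supplied by the root count, kills
    those above n. *)
Lemma stirling_poly_gf (R : numDomainType) n : (0 < n)%N ->
  size (descent_gf R n) = n.+1 -> stirling_poly R n = descent_gf R n.
Proof.
move=> n0 sn.
have cE j : (descent_gf R n)`_j = (stirling_count n j)%:R.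
  rewrite coef_sum /stirling_count -sum1_count natr_sum [RHS]big_mkcond /=.
  by apply: eq_bigr => q _; rewrite coefXn eq_sym; case: eqP.
apply/polyP => j; rewrite cE coef_sum.
under eq_bigr do rewrite coefZ coefXn.
have [jn|jn] := boolP (j \in index_iota 1 n.+1).
  rewrite (bigD1_seq j) ?iota_uniq //= eqxx mulr1 big1 ?addr0 // => i /negPf.
  by rewrite eq_sym => ->; rewrite mulr0.
rewrite big1_seq => [|i /= Hi]; last first.
  by rewrite (_ : j == i = false) ?mulr0 //; apply: contraNF jn => /eqP->.
rewrite -cE; move: jn; rewrite mem_index_iota negb_and -leqNgt -leqNgt leqn0.
move=> /orP[/eqP->|jn]; last by rewrite nth_default // sn.
by case: n {sn cE} n0 => // n _; rewrite descent_gfS -horner_coef0 !hornerE.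
Qed.

(** * Real roots by interlacing *)

Import Order.TTheory.

Definition has_npos_roots (R : rcfType) (n : nat) (p : {poly R}) (s : seq R) :=
  [/\ size p = n.+1, 0 < lead_coef p, size s = n, sorted <%R s &
      all (fun x => root p x && (x <= 0)) s].

Lemma has_npos_rootsE (R : rcfType) n (p : {poly R}) s :
  has_npos_roots n p s -> p = lead_coef p *: \prod_(z <- s) ('X - z%:P).
Proof.
case=> sp _ ss os rs; apply: all_roots_prod_XsubC; rewrite ?ss //.
  by apply: sub_all rs => x /andP[].
by rewrite uniq_rootsE (sorted_uniq lt_trans ltxx).
Qed.

(** The derivative at s_i is the leading coefficient times the product of s_i - s_j over j != i, and
    exactly the n - i - 1 factors with j > i are negative. *)
Lemma sgr_deriv_root (R : rcfType) n (p : {poly R}) s i :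
  has_npos_roots n p s -> (i < n)%N -> Num.sg p^`().[s`_i] = (-1) ^+ (n - i.+1).
Proof.
move=> H lin; have pE := has_npos_rootsE H; case: H => sp lp ss os rs.
have -> : p^`().[s`_i] = lead_coef p * \prod_(0 <= j < n | j != i) (s`_i - s`_j).
  rewrite pE derivZ hornerZ -pE (big_nth 0) ss (bigD1_seq i) ?iota_uniq //=; last first.
    by rewrite mem_index_iota.
  rewrite derivM derivXsubC hornerD !hornerM !hornerXsubC subrr mul0r addr0.
  rewrite hornerC mul1r horner_prod; congr (_ * _).
  by apply: eq_bigr => j _; rewrite hornerXsubC.
rewrite sgrM gtr0_sg // mul1r.
rewrite (big_cat_nat (n := i)) //=; last exact: ltnW.
rewrite [X in _ * X]big_ltn_cond // eqxx /= sgrM.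
rewrite gtr0_sg ?mul1r; last first.
  rewrite big_seq_cond prodr_gt0 // => j.
  rewrite mem_index_iota => /andP[/andP[_ ji] _].
  by rewrite subr_gt0 (sorted_ltn_nth lt_trans) // inE ss // (ltn_trans ji).
rewrite (big_morph _ (@sgrM R) (@sgr1 R)) big_nat_cond.
rewrite (eq_bigr (fun=> -1)) => [|j /andP[/andP[ij jn] _]]; last first.
  by rewrite ltr0_sg // subr_lt0 (sorted_ltn_nth lt_trans) // inE ss.
rewrite (eq_bigl (fun j => (i.+1 <= j < n)%N)); last first.
  by move=> j /=; case: ltngtP; rewrite ?andbT ?andbF.
by rewrite -big_nat prodr_const_nat.
Qed.

Section Interlacing.
Variables (R : rcfType) (n : nat) (p : {poly R}) (s : seq R).
Hypothesis H : has_npos_roots n p s.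
Let D := (1 - 'X) * p^`() + n.*2.+1%:R * p.

(** The summand with [p] vanishes at s_i, and 1 - s_i > 0 since s_i <= 0. *)
Let sgD i : (i < n)%N -> Num.sg D.[s`_i] = (-1) ^+ (n - i.+1).
Proof.
move=> lin; rewrite -(sgr_deriv_root H lin); case: H => sp lp ss os /all_nthP rs.
have /andP[/eqP rsi lsi] : root p s`_i && (s`_i <= 0) by apply: rs; rewrite ss.
rewrite /D hornerD !hornerM rsi mulr0 addr0 !hornerE sgrM gtr0_sg ?mul1r //.
by rewrite subr_gt0 (le_lt_trans lsi).
Qed.

Let coefD i : D`_i = p`_i.+1 *+ i.+1 - p`_i *+ i + p`_i *+ n.*2.+1.
Proof.
rewrite /D coefD mulrBl mul1r coefB mulr_natl coefMn coefXM !coef_deriv.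
by case: i => // i; rewrite mulr0n.
Qed.

(** The coefficient of [p] at n + 1 is zero, which leaves (2n + 1) - n copies of the leading one. *)
Let coefDn : D`_n = lead_coef p *+ n.+1.
Proof.
case: H => sp _ _ _ _; rewrite coefD lead_coefE sp /= nth_default ?sp // mul0rn sub0r.
by rewrite addrC -mulrnBr -?addnn ?leqW ?leq_addr // subSn ?leq_addr // addnK.
Qed.

Let coefDn_gt0 : 0 < D`_n.
Proof. by case: H => *; rewrite coefDn pmulrn_lgt0. Qed.

Let sizeD : size D = n.+1.
Proof.
apply/eqP; rewrite eqn_leq; apply/andP; split.
  apply/leq_sizeP => j nj; case: H => sp _ _ _ _.
  by rewrite coefD !nth_default ?sp ?mul0rn ?subr0 ?addr0 // ltnW.
by rewrite ltnNge; apply: contraTN coefDn_gt0 => /leq_sizeP->; rewrite ?ltxx.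
Qed.

Let D_neq0 : D != 0. Proof. by rewrite -size_poly_eq0 sizeD. Qed.

Let lcD : lead_coef D = D`_n. Proof. by rewrite lead_coefE sizeD. Qed.

Let D_ivt k a b : a <= b -> Num.sg D.[a] = (-1) ^+ k.+1 -> Num.sg D.[b] = (-1) ^+ k ->
  exists x, [/\ root D x, a < x & x < b].
Proof.
move=> ab Da Db; have [|x xab rx] := @poly_ivtoo R D a b ab.
  by rewrite -sgr_cp0 sgrM Da Db exprS -mulrA -expr2 sqrr_sign mulr1.
by exists x; rewrite !(itvP xab).
Qed.

(** The lower bound is an implication so that it is vacuous at i = 0, where the interval is
    unbounded below. *)
Let D_root (i : 'I_n) : exists x, [/\ root D x, x < s`_i &
  forall j, nat_of_ord i = j.+1 -> s`_j < x].
Proof.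
case: i => -[|i] lin /=.
  (* Below the Cauchy bound [D] has its sign at -oo, here (-1)^n; the minimum also puts [y] to the
     left of s_0. *)
  pose y := Num.min (- cauchy_bound D) s`_0.
  have sy : Num.sg D.[y] = (-1) ^+ (n - 1).+1.
    rewrite (sgp_minftyP (le_cauchy_bound D_neq0)) ?in_itv /= ?ge_min ?lexx //.
    rewrite /sgp_minfty sizeD sgrM sgrX sgrN1 lcD (gtr0_sg coefDn_gt0) mulr1.
    by rewrite subn1 prednK.
  have [|x [rx _ xs]] := D_ivt _ sy (sgD lin); first by rewrite ge_min lexx orbT.
  by exists x.
have lin' := ltnW lin.
have si : s`_i < s`_i.+1.
  by case: H => _ _ ss os _; rewrite (sorted_ltn_nth lt_trans) // inE ss.
have [|x [rx sx xs]] := D_ivt (ltW si) _ (sgD lin).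
  by rewrite sgD // subnSK.
by exists x; split=> // j [<-].
Qed.

Lemma has_npos_rootsS : exists t, has_npos_roots n.+1 ('X * D) t.
Proof.
have [f Hf] := fin_all_exists D_root.
pose t := [seq f i | i <- enum 'I_n].
have st : size t = n by rewrite size_map size_enum_ord.
have nt (i : 'I_n) : t`_i = f i.
  by rewrite (nth_map i) ?size_enum_ord // nth_ord_enum.
have [sp lp ss os rs] := H.
have t_lt (i : 'I_n) : f i < 0.
  have [_ xs _] := Hf i; apply: (lt_le_trans xs).
  by move/all_nthP: rs => /(_ 0 i); rewrite ss => /(_ (ltn_ord i))/andP[].
(* Each root of [D] found lies strictly below some s_i <= 0, so the root 0 of the factor ['X] comes
   last and is new. *)
exists (rcons t 0); split.
- by rewrite mulrC size_mulX // sizeD.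
- by rewrite lead_coefM lead_coefX mul1r lcD.
- by rewrite size_rcons st.
- apply/(sortedP 0) => i; rewrite size_rcons st ltnS => lin.
  rewrite !nth_rcons st lin (nt (Ordinal lin)); case: ltnP => lin'.
    rewrite (nt (Ordinal lin')); have [_ xs _] := Hf (Ordinal lin).
    by have [_ _ /(_ i erefl)] := Hf (Ordinal lin'); apply: lt_trans.
  by rewrite if_same.
rewrite all_rcons rootM rootX eqxx lexx /=; apply/allP => _ /mapP[i _ ->].
by rewrite rootM (ltW (t_lt i)) andbT; have [-> _ _] := Hf i; rewrite orbT.
Qed.

End Interlacing.

Lemma descent_gf_npos_roots (R : rcfType) n :
  exists s, has_npos_roots n (descent_gf R n) s.
Proof.
elim: n => [|n [s Hs]].
  by exists [::]; rewrite descent_gf0; split; rewrite ?size_poly1 ?lead_coef1 ?ltr01.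
by rewrite descent_gfS; apply: has_npos_rootsS Hs.
Qed.

(** * Transfer to the complex numbers *)

Lemma map_stirling_poly (A B : nzRingType) (f : {rmorphism A -> B}) n :
  map_poly f (stirling_poly A n) = stirling_poly B n.
Proof.
rewrite rmorph_sum /=; apply: eq_bigr => i _.
by rewrite map_polyZ map_polyXn rmorph_nat.
Qed.

Lemma mup_prod_XsubC (F : fieldType) (z : F) s : uniq s -> z \in s ->
  mup z (\prod_(x <- s) ('X - x%:P)) = 1%N.
Proof.
move=> us zs; rewrite (bigD1_seq z) //= mupMl.
  by rewrite -['X - _]expr1 mup_XsubCX eqxx.
by rewrite -big_filter root_prod_XsubC mem_filter eqxx.
Qed.

Local Open Scope complex_scope.

Theorem theorem1 (R : rcfType) (n : nat) (hn : (0 < n)%N) (z : R[i])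
    (hz : root (stirling_poly R[i] n) z) :
  [/\ z \is Num.real, z <= 0 & mup z (stirling_poly R[i] n) = 1%N].
Proof.
have [s Hs] := descent_gf_npos_roots R n.
have pE := has_npos_rootsE Hs; case: Hs => sp lp ss os rs.
set c := lead_coef _ in pE lp.
pose cs := [seq x%:C | x <- s].
(* The real factorization is already complete, so over [R[i]] there are no roots beyond the images
   of [s]; distinctness of [s] makes each of them simple. *)
have qE : stirling_poly R[i] n = c%:C *: \prod_(w <- cs) ('X - w%:P).
  rewrite -(map_stirling_poly (real_complex R)) stirling_poly_gf // pE.
  by rewrite map_polyZ map_prod_XsubC big_map.
have c0 : c%:C != 0 by rewrite fmorph_eq0 gt_eqF.
move: hz; rewrite qE rootZ // root_prod_XsubC => zs.
have ucs : uniq cs.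
  by rewrite (map_inj_uniq (@complexI R)) (sorted_uniq lt_trans ltxx).
rewrite -mul_polyC mupMr ?rootC // mup_prod_XsubC //.
have /mapP[x xs ->] := zs; split=> //; first by apply/complex_realP; exists x.
by rewrite lecR; have /andP[] := allP rs _ xs.
Qed.
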